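(* Let $\Omega$ be an infinite set, and let $J$ be any set of cardinality $\le\mathrm{card}(\Omega)$. Then $L^{\le\mathrm{const}}_{\mathrm{Equiv}(\Omega),J}$ contains no chains with $>\mathrm{card}(\Omega)$ jumps. Hence for any lattice $A$ embeddable in $\mathrm{Equiv}(\Omega)$, $L^{\le\mathrm{const}}_{A,J}$ contains no such chains.
   Context: $\mathrm{Equiv}(\Omega)$ is the lattice of equivalence relations on $\Omega$, ordered by inclusion. For a lattice $A$, a set $J$, a lattice word $v$ (in the operations $\wedge,\vee$) in a $J$-tuple of variables with constants in $A$, and an element $c\in A$, let $S_{v\le c}=\{a=(a_j)_{j\in J}\in A^J\mid v(a)\le c\}$; such sets are called principal lower solution sets in $A^J$. A lower solution set is the intersection of an arbitrary family of principal lower solution sets (the empty intersection being $A^J$). $L^{\le\mathrm{const}}_{A,J}$ denotes the complete lattice of all lower solution sets in $A^J$, ordered by inclusion. A chain is a totally ordered subset. A jump in a totally ordered set $C$ is a pair $x<y$ in $C$ such that no $z\in C$ satisfies $x<z<y$. A lattice embedding is an injective map preserving binary meet and join. *)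

(* Defs.v *)
From HB Require Import structures.
From Corelib Require Import RelationClasses.
From mathcomp Require Import all_boot all_order.
From mathcomp Require Import boolp classical_sets functions cardinality.

Set Implicit Arguments.
Unset Strict Implicit.
Unset Printing Implicit Defensive.

Import Order.TTheory.
Local Open Scope order_scope.
Local Open Scope classical_set_scope.
Local Open Scope card_scope.

(* Strict inequality of cardinals: card A < card B. *)
Definition card_lt (T U : Type) (A : set T) (B : set U) : Prop :=
  (A #<= B) /\ ~ (B #<= A).

Record Equiv (Omega : Type) := MkEquiv {
  equiv_rel :> Omega -> Omega -> Prop;
  equiv_relP : Equivalence equiv_rel
}.

Section EquivLattice.
Variable Omega : Type.
Implicit Types e f g : Equiv Omega.

Definition equiv_le e f : bool := `[< forall x y, e x y -> f x y >].

Lemma equiv_meetP e f : Equivalence (fun x y => e x y /\ f x y).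
Proof.
have [er es et] := equiv_relP e; have [fr fs ft] := equiv_relP f.
split=> [x|x y [exy fxy]|x y z [exy fxy] [eyz fyz]]; split.
- exact: er.
- exact: fr.
- exact: es.
- exact: fs.
- exact: et exy eyz.
- exact: ft fxy fyz.
Qed.

Definition equiv_meet e f : Equiv Omega := MkEquiv (equiv_meetP e f).

Lemma equiv_joinP e f :
  Equivalence (fun x y => forall g, equiv_le e g -> equiv_le f g -> g x y).
Proof.
split=> [x g _ _|x y H g eg fg|x y z H K g eg fg];
  have [gr gs gt] := equiv_relP g.
- exact: gr.
- exact/gs/H.
- exact: gt (H _ eg fg) (K _ eg fg).
Qed.

(* The smallest equivalence relation containing both e and f. *)
Definition equiv_join e f : Equiv Omega := MkEquiv (equiv_joinP e f).

HB.instance Definition _ := gen_eqMixin (Equiv Omega).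
HB.instance Definition _ := gen_choiceMixin (Equiv Omega).

Lemma equiv_le_refl : reflexive equiv_le.
Proof. by move=> e; apply/asboolP. Qed.

Lemma equiv_le_anti : antisymmetric equiv_le.
Proof.
move=> [e eP] [f fP] /andP[/asboolP /= ef /asboolP /= fe].
have eqef : e = f by apply/funext=> x; apply/funext=> y; apply/propext; split; auto.
by subst f; congr MkEquiv; apply: Prop_irrelevance.
Qed.

Lemma equiv_le_trans : transitive equiv_le.
Proof. by move=> f e g /asboolP ef /asboolP fg; apply/asboolP; auto. Qed.

Fact equiv_display : Order.disp_t. Proof. exact: Order.Disp. Qed.

HB.instance Definition _ := Order.Le_isPOrder.Build equiv_display (Equiv Omega)
  equiv_le_refl equiv_le_anti equiv_le_trans.

Lemma equiv_lexI e f g : (e <= equiv_meet f g) = (e <= f) && (e <= g).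
Proof.
apply/idP/andP => [/asboolP H|[/asboolP H /asboolP K]].
  by split; apply/asboolP => x y /H[].
by apply/asboolP => x y exy; split; auto.
Qed.

Lemma equiv_leUx e f g : (equiv_join e f <= g) = (e <= g) && (f <= g).
Proof.
apply/idP/andP => [/asboolP H|[eg fg]].
  by split; apply/asboolP => x y xy; apply: H => h /asboolP eh /asboolP fh; auto.
by apply/asboolP => x y; apply.
Qed.

HB.instance Definition _ := Order.POrder_MeetJoin_isLattice.Build
  equiv_display (Equiv Omega) equiv_lexI equiv_leUx.

End EquivLattice.

Inductive lattice_word (A J : Type) :=
| WVar of J
| WConst of A
| WMeet of lattice_word A J & lattice_word A J
| WJoin of lattice_word A J & lattice_word A J.

Section LowerSolutionSets.
Variables (d : Order.disp_t) (A : latticeType d) (J : Type).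

Fixpoint eval_word (v : lattice_word A J) (a : J -> A) : A :=
  match v with
  | WVar j => a j
  | WConst c => c
  | WMeet v1 v2 => (eval_word v1 a `&` eval_word v2 a)%O
  | WJoin v1 v2 => (eval_word v1 a `|` eval_word v2 a)%O
  end.

Definition principal_solution_set (v : lattice_word A J) (c : A) :
  set (J -> A) := [set a | eval_word v a <= c].

Definition principal_lower_solution_sets : set (set (J -> A)) :=
  [set S | exists v c, S = principal_solution_set v c].

Definition lower_solution_sets : set (set (J -> A)) :=
  [set X | exists2 F : set (set (J -> A)),
     F `<=` principal_lower_solution_sets & X = \bigcap_(S in F) S].

(* The subtype of the lower solution sets; its order is the restriction of the
   library's order on set (J -> A), which is inclusion. *)
Definition L_le_const := set_type lower_solution_sets.

HB.instance Definition _ := SubChoice.on L_le_const.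
HB.instance Definition _ :=
  [SubChoice_isSubPOrder of L_le_const by <: with set_display].

End LowerSolutionSets.

Arguments L_le_const {d} A J.

Section Chains.
Variables (d : Order.disp_t) (L : porderType d).

Definition chain (C : set L) : Prop :=
  forall x y, C x -> C y -> x <= y \/ y <= x.

Definition jumps (C : set L) : set (L * L) :=
  [set p | [/\ C p.1, C p.2, p.1 < p.2 &
               ~ exists z, [/\ C z, p.1 < z & z < p.2]]].

End Chains.

Definition lattice_embedding d (A : latticeType d) d' (B : latticeType d')
    (f : A -> B) : Prop :=
  [/\ injective f, {morph f : x y / (x `&` y)%O >-> (x `&` y)%O} &
      {morph f : x y / (x `|` y)%O >-> (x `|` y)%O}].

(* Main.v *)
(* An equivalence relation generated by others is built by finite derivations,
   so whether (x, y) lies in v(a) depends on finitely many membership facts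
   "(p, q) lies in a_j": the condition is open in the variables, whatever the
   constants of v are.  Hence every lower solution set is an intersection of
   complements of basic open sets, and these are indexed by the finite
   sequences over J * Omega * Omega, of which there are at most card(Omega).
   Across a jump X < Y some such complement contains X and not Y; in a chain,
   distinct jumps are separated by distinct complements. *)
Require Import Defs.
From mathcomp Require Import all_boot all_order.
From mathcomp Require Import boolp classical_sets functions cardinality.

Local Open Scope classical_set_scope.
Local Open Scope card_scope.

Set Implicit Arguments.
Unset Strict Implicit.
Unset Printing Implicit Defensive.

Import Order.TTheory.

(** In both uses of Zorn's lemma below, conditions on two points of a union are checked inside a
    single member of the chain. *)
Lemma bigcup_chain2 (T : Type) (F : set (set T)) (p q : T) :
  total_on F subset -> (\bigcup_(G in F) G) p -> (\bigcup_(G in F) G) q ->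
  exists G, [/\ F G, G p & G q].
Proof.
move=> Ftot [G FG Gp] [H FH Hq]; have [GH|HG] := Ftot _ _ FG FH.
  by exists H; split=> //; exact: GH.
by exists G; split=> //; exact: HG.
Qed.

(** * Comparability of cardinals *)

Section CardinalComparison.
Variables (T U : Type).
Implicit Types (A : set T) (B : set U).

Lemma inj_card_leP A B (f : T -> U) :
  (forall x, A x -> B (f x)) -> {in A &, injective f} -> A #<= B.
Proof.
move=> fAB finj; rewrite -(card_le_eql (inj_card_eq finj)).
by apply: subset_card_le => _ [x Ax <-]; exact: fAB.
Qed.

(** A point of [B] serves as the value outside [A], so that the injection becomes a total function
    on [T]. *)
Lemma card_le_fun A B : B !=set0 -> A #<= B ->
  exists2 f : T -> U, forall x, A x -> B (f x) & {in A &, injective f}.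
Proof.
move=> [b Bb] /card_leP[f].
pose g x := if pselect (A x) is left Ax
  then val (f (SigSub (mem_set Ax))) else b.
exists g => [x Ax|x y /set_mem Ax /set_mem Ay]; rewrite /g.
  by case: pselect => // ?; exact/set_mem/valP.
case: pselect => // {}Ax; case: pselect => // {}Ay /val_inj fxy.
by have /(congr1 val) := inj (in_setT _) (in_setT _) fxy.
Qed.

Let partial_injection A B (G : set (T * U)) :=
  [/\ forall x y, G (x, y) -> A x /\ B y,
      forall x y z, G (x, y) -> G (x, z) -> y = z &
      forall x y z, G (x, z) -> G (y, z) -> x = y].

(** A maximal graph of a partial injection has all of [A] as domain or all of [B] as range:
    otherwise a pair [(a, b)] missed on both sides could be added. *)
Lemma card_le_total A B : A #<= B \/ B #<= A.
Proof.
have [|G [[GAB Gfun Ginj] Gmax]] := @Zorn_bigcup _ (partial_injection A B).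
  move=> F Fpinj Ftot; split=> [x y [G FG Gxy]|x y z xy xz|x y z xz yz].
  - by have [+ _ _] := Fpinj _ FG; apply.
  - have [G [/Fpinj[_ + _] Gxy Gxz]] := bigcup_chain2 Ftot xy xz.
    by apply; eassumption.
  - have [G [/Fpinj[_ _ +] Gxz Gyz]] := bigcup_chain2 Ftot xz yz.
    by apply; eassumption.
have [domG|/existsNP[a /not_implyP[Aa noa]]] :=
    pselect (forall x, A x -> exists y, G (x, y)).
  (* A nonempty [A] yields a point [b] of [U], the default value outside [A]. *)
  left; have [->|/set0P[a Aa]] := eqVneq A set0; first exact: card_ge0.
  have [b Gab] := domG a Aa.
  have [f fG] : {f : T -> U & forall x, A x -> G (x, f x)}.
    apply: (@choice _ _ (fun x y => A x -> G (x, y))) => x.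
    have [/domG[y Gxy]|nAx] := pselect (A x); first by exists y.
    by exists b.
  apply: (@inj_card_leP _ _ f) => [x /fG/GAB[]//|x y /set_mem/fG Gx].
  by move=> /set_mem/fG Gy fxy; rewrite fxy in Gx; exact: Ginj Gx Gy.
have [ranG|/existsNP[b /not_implyP[Bb nob]]] :=
    pselect (forall y, B y -> exists x, G (x, y)).
  right; have [g gG] : {g : U -> T & forall y, B y -> G (g y, y)}.
    apply: (@choice _ _ (fun y x => B y -> G (x, y))) => y.
    have [/ranG[x Gxy]|nBy] := pselect (B y); first by exists x.
    by exists a.
  have /inj_card_eq eB : {in B &, injective g}.
    move=> x y /set_mem/gG Gx /set_mem/gG Gy gxy.
    by rewrite gxy in Gx; exact: Gfun Gx Gy.
  rewrite -(card_le_eql eB); apply: subset_card_le => _ [y /gG/GAB[Agy _] <-].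
  exact: Agy.
have [] := Gmax ((a, b) |` G).
  split; first exact: subsetUr.
  by move=> /(_ (a, b) (or_introl erefl)) Gab; apply: noa; exists b.
split=> [x y [[-> ->]|/GAB]//|x y z|x y z].
- move=> [[-> ->]|Gxy] [[] // |Gxz].
  + by case: noa; exists z.
  + by move=> xa _; case: noa; exists y; rewrite -xa.
  + exact: Gfun Gxy Gxz.
- move=> [[-> ->]|Gxz] [[] // |Gyz].
  + by case: nob; exists y.
  + by move=> _ zb; case: nob; exists x; rewrite -zb.
  + exact: Ginj Gxz Gyz.
Qed.

End CardinalComparison.

(** * Pairing functions and finite sequences on an infinite set *)

Section InfiniteSquare.
Variable T : Type.
Implicit Types (D E : set T) (G : set ((T * T) * T)).

(** For the graph [G] of a map D * D -> D, the diagonal recovers D. Zorn's lemma can then be applied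
    to graphs alone, without carrying D along. *)
Let field G : set T := [set x | exists z, G ((x, x), z)].

Let square_injection G :=
  [/\ forall p y z, G (p, y) -> G (p, z) -> y = z,
      forall p q z, G (p, z) -> G (q, z) -> p = q,
      forall x y z, G ((x, y), z) -> [/\ field G x, field G y & field G z] &
      forall x y, field G x -> field G y -> exists z, G ((x, y), z)].

Let pairing E D (f : T -> T -> T) :=
  (forall x y, E x -> E y -> D (f x y)) /\
  (forall x y x' y', E x -> E y -> E x' -> E y' ->
     f x y = f x' y' -> x = x' /\ y = y').

Lemma square_injection_pairing G : field G !=set0 -> square_injection G ->
  exists2 f, pairing (field G) (field G) f &
    forall x y, field G x -> field G y -> G ((x, y), f x y).
Proof.
move=> [d _] [Gfun Ginj Gfield Gtot].
have [f fG] : {f : T * T -> T &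
    forall p, field G p.1 -> field G p.2 -> G (p, f p)}.
  apply: (@choice _ _ (fun p z => field G p.1 -> field G p.2 -> G (p, z))).
  move=> [x y] /=.
  have [/(Gtot x)Gx|ny] := pselect (field G y); last by exists d.
  have [/Gx[z Gz]|nx] := pselect (field G x); last by exists d.
  by exists z.
exists (fun x y => f (x, y)) => [|x y Dx Dy]; last exact: (fG (x, y)).
split=> [x y Dx Dy|x y x' y' Dx Dy Dx' Dy' exy].
  by have [] := Gfield _ _ _ (fG (x, y) Dx Dy).
have Gxy := fG (x, y) Dx Dy; have := fG (x', y') Dx' Dy'.
by rewrite -exy => /(Ginj _ _ _ Gxy)[-> ->].
Qed.

(* f(d, -) and f(e, -) embed two disjoint copies of D into D; one of them
   receives D, the other one E \ D. *)
Lemma pairing_extend D E f d e : pairing D D f -> D d -> D e -> d <> e ->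
  (E `\` D) #<= D -> exists g, pairing E D g.
Proof.
move=> [fD finj] Dd De de /(card_le_fun (ex_intro _ d Dd))[k kD kinj].
pose u x := if pselect (D x) then f d x else f e (k x).
have kDx x : E x -> ~ D x -> D (k x) by move=> Ex nDx; exact: kD.
have uD x : E x -> D (u x).
  by move=> Ex; rewrite /u; case: pselect => Dx; apply: fD => //; exact: kDx.
have uinj x y : E x -> E y -> u x = u y -> x = y.
  move=> Ex Ey; rewrite /u; case: pselect => Dx; case: pselect => Dy.
  - by case/finj.
  - by case/finj => //; exact: kDx.
  - by case/finj => // [|/esym//]; exact: kDx.
  - case/finj => //; [exact: kDx|exact: kDx|move=> _ kxy].
    by apply: kinj; rewrite ?inE.
exists (fun x y => f (u x) (u y)); split=> [x y Ex Ey|x y x' y' Ex Ey Ex' Ey'].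
  by apply: fD; exact: uD.
by case/finj; try exact: uD; move=> /uinj-> // /uinj->.
Qed.

(** A copy of [nat] inside [T] inherits the pairing given by [pickle]. This shows that a maximal
    graph is not empty. *)
Lemma infinite_square_injection : infinite_set [set: T] ->
  exists G, infinite_set (field G) /\ square_injection G.
Proof.
move=> Tinf.
have [i _ iinj] := card_le_fun (infinite_setN0 Tinf) (iffLR (infiniteP _) Tinf).
have {}iinj m n : i m = i n -> m = n by apply: iinj; rewrite inE.
pose G := [set ((i p.1, i p.2), i (pickle p)) | p in [set: nat * nat]].
have fieldG n : field G (i n) by exists (i (pickle (n, n))), (n, n).
have fieldG_inv x : field G x -> exists n, x = i n.
  by move=> [z [[m n] _ [<- _ _]]]; exists m.
exists G; split.
  by apply/infiniteP; apply: (@inj_card_leP _ _ _ _ i) => // m n _ _ /iinj.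
split=> [p y z|p q z|x y z|x y].
- move=> [[m n] _ [<- <-]] [[m' n'] _ [/iinj-> /iinj-> <-]] //.
- move=> [[m n] _ [<- <-]] [[m' n'] _ [<-]].
  by move=> /iinj/(pcan_inj pickleK)[-> ->].
- by move=> [[m n] _ [<- <- <-]].
- move=> /fieldG_inv[m ->] /fieldG_inv[n ->].
  by exists (i (pickle (m, n))), (m, n).
Qed.

(* Hessenberg's theorem.  Take an injection D * D -> D on a maximal infinite D.
   If the complement of D contained a copy h(D), the injection would extend to
   D + h(D), the new pairs being sent to h(D); so the complement is at most as
   large as D, and T itself embeds into D. *)
Lemma infinite_pairing : infinite_set [set: T] ->
  exists f : T -> T -> T, forall x y x' y', f x y = f x' y' -> x = x' /\ y = y'.
Proof.
move=> Tinf.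
pose P G := G = set0 \/ infinite_set (field G) /\ square_injection G.
have [|G [PG Gmax]] := @Zorn_bigcup _ P.
  move=> F FP Ftot; have [noG|] := pselect (forall G, F G -> G = set0).
    by left; rewrite -subset0 => p [G /noG->].
  move=> /existsNP[G0 /not_implyP[FG0 G0n0]]; right.
  have Fsq G p : F G -> G p -> square_injection G.
    by move=> /FP[->//|[_]].
  have fieldS G : F G -> field G `<=` field (\bigcup_(H in F) H).
    by move=> FG x [z Gz]; exists z, G.
  split.
    have [//|[infG0 _]] := FP _ FG0.
    exact: sub_infinite_set (fieldS _ FG0) infG0.
  split=> [p y z py pz|p q z pz qz|x y z [G FG Gxyz]|x y [u xu] [v yv]].
  - have [G [FG Gy Gz]] := bigcup_chain2 Ftot py pz.
    by have [+ _ _ _] := Fsq _ _ FG Gy; apply; eassumption.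
  - have [G [FG Gp Gq]] := bigcup_chain2 Ftot pz qz.
    by have [_ + _ _] := Fsq _ _ FG Gp; apply; eassumption.
  - have [_ _ Gfield _] := Fsq _ _ FG Gxyz.
    by have [] := Gfield _ _ _ Gxyz; split; apply: fieldS FG _ _.
  - have [G [FG Gx Gy]] := bigcup_chain2 Ftot xu yv.
    have [_ _ _ Gtot] := Fsq _ _ FG Gx.
    have [z Gz] := Gtot x y (ex_intro _ u Gx) (ex_intro _ v Gy).
    by exists z, G.
case: PG => [G0|[infD Gsq]].
  have [H [infH Hsq]] := infinite_square_injection Tinf.
  have [] := Gmax H; last by right.
  rewrite G0; split; first exact: sub0set.
  move=> H0; have [x [z Hx]] := infinite_setN0 infH; exact: (H0 _ Hx).
have [f fpair fG] := square_injection_pairing (infinite_setN0 infD) Gsq.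
have [Gfun Ginj Gfield Gtot] := Gsq.
have [i iD iinj] :=
  card_le_fun (infinite_setN0 infD) (iffLR (infiniteP _) infD).
(* These are the two distinct points of D that [pairing_extend] requires. *)
have i01 : i 0%N <> i 1%N by move=> /iinj; rewrite !inE => /(_ I I).
have pext E := @pairing_extend _ E _ _ _ fpair (iD 0%N I) (iD 1%N I) i01.
set D := field G in infD fpair fG Gfield Gtot iD pext *.
have [DC|CD] := card_le_total D (~` D); last first.
  have [|g [_ ginj]] := pext setT; first by rewrite setTD.
  by exists g => x y x' y'; exact: ginj.
have nD0 : (~` D) !=set0.
  apply/set0P/eqP => nD0; move: DC; rewrite nD0 => /card_le0P D0.
  by have := infinite_setN0 infD; rewrite D0 => -[].
have [h hD hinj] := card_le_fun nD0 DC.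
have {}hinj x y : D x -> D y -> h x = h y -> x = y.
  by move=> Dx Dy; apply: hinj; rewrite inE.
pose E := D `|` h @` D.
have [|g [gD ginj]] := pext E.
  by apply: card_le_trans (card_image_le h D); apply: subset_card_le => x [[]].
(* The arguments lie outside D * D and the values outside D, so [new] conflicts with [G] neither as
   a function nor for injectivity. *)
pose new := [set p : (T * T) * T | [/\ E p.1.1, E p.1.2,
  ~ (D p.1.1 /\ D p.1.2) & p.2 = h (g p.1.1 p.1.2)]].
have GnewD p y z : G (p, y) -> ~ new (p, z).
  by case: p => x x' /Gfield[Dx Dx' _] [_ _ +] => /(_ (conj Dx Dx')).
have GnewR p q z : G (p, z) -> ~ new (q, z).
  case: p q => x y [x' y'] /Gfield[_ _ Dz] [/= Ex Ey _ zE].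
  by have := hD _ (gD _ _ Ex Ey); rewrite -zE; apply.
have newT x y : E x -> E y -> exists z, (G `|` new) ((x, y), z).
  move=> Ex Ey; have [[Dx Dy]|nD] := pselect (D x /\ D y).
    by have [z Gz] := Gtot x y Dx Dy; exists z; left.
  by exists (h (g x y)); right.
have fieldE : field (G `|` new) = E.
  apply/seteqP; split=> [x [z [/Gfield[Dx _ _]|[]//]]|x Ex]; first by left.
  exact: newT.
have [] := Gmax (G `|` new).
  split; first exact: subsetUl.
  (* The extension is proper: [h (i 0)] enters the field but lies outside D. *)
  move=> newG; have Dd := iD 0%N I.
  have Ed : E (h (i 0%N)) by right; exists (i 0%N).
  have [z /newG/Gfield[Dhd _ _]] := newT _ _ Ed Ed.
  exact: hD Dd Dhd.
right; rewrite /square_injection fieldE; split.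
  by apply: sub_infinite_set infD; exact: subsetUl.
split.
- move=> p y z [py|py] [pz|pz].
  + exact: Gfun py pz.
  + by case: (GnewD _ _ _ py pz).
  + by case: (GnewD _ _ _ pz py).
  + by case: py => _ _ _ /= ->; case: pz => _ _ _ /= ->.
- move=> p q z [pz|pz] [qz|qz].
  + exact: Ginj pz qz.
  + by case: (GnewR _ _ _ pz qz).
  + by case: (GnewR _ _ _ qz pz).
  + case: p q pz qz => x y [x' y'] [/= Ex Ey _ ->] [/= Ex' Ey' _].
    have ginjE := ginj _ _ _ _ Ex Ey Ex' Ey'.
    by move=> /(hinj _ _ (gD _ _ Ex Ey) (gD _ _ Ex' Ey'))/ginjE[-> ->].
- move=> x y z [/Gfield[Dx Dy Dz]|[/= Ex Ey _ ->]]; first by split; left.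
  by split=> //; right; exists (g x y) => //; exact: gD.
- exact: newT.
Qed.

End InfiniteSquare.

Lemma infinite_seq_card_le (T : Type) : infinite_set [set: T] ->
  [set: seq T] #<= [set: T].
Proof.
move=> Tinf; have [f finj] := infinite_pairing Tinf.
have [i _ iinj] := card_le_fun (infinite_setN0 Tinf) (iffLR (infiniteP _) Tinf).
(* The length is recorded because the fold alone may identify sequences of different lengths. *)
pose code s := f (i (size s)) (foldr f (i 0%N) s).
apply: (@inj_card_leP _ _ _ _ code) => // s t _ _ /finj[+ st].
move=> /iinj; rewrite !inE => /(_ I I).
elim: s t st => [|x s IH] [|y t] // /finj[-> st] [sz].
by rewrite (IH _ st sz).
Qed.

(** * Finite tests on tuples of equivalence relations *)

Section BasicOpenSets.
Variables (Omega J : Type).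
Implicit Types (b : J -> Equiv Omega) (s : seq (J * (Omega * Omega))).

Definition satisfies b s : bool :=
  all (fun t => `[< b t.1 t.2.1 t.2.2 >]) s.

(** By induction on the word: a variable needs one membership fact, a constant none, and a meet the
    concatenation of two tests. *)
Lemma eval_word_open (v : lattice_word (Equiv Omega) J) b x y :
  eval_word v b x y -> exists2 s, satisfies b s &
    forall b', satisfies b' s -> eval_word v b' x y.
Proof.
elim: v x y => [j|c|v IHv w IHw|v IHv w IHw] x y /=.
- move=> bxy; exists [:: (j, (x, y))] => [|b']; rewrite /satisfies /= andbT.
    exact/asboolP.
  by move/asboolP.
- by move=> cxy; exists [::].
- move=> [/IHv[s bs sv] /IHw[t bt tw]]; exists (s ++ t).
    by rewrite /satisfies all_cat; apply/andP.
  by move=> b'; rewrite /satisfies all_cat => /andP[/sv ? /tw ?].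
(* Explicit derivations are avoided: [R] is an equivalence relation, with transitivity by
   concatenating tests, and it contains the values of [v] and [w] at [b]. It therefore contains
   their join, the smallest such relation. *)
pose R x y := exists2 s, satisfies b s &
  forall b', satisfies b' s -> eval_word (WJoin v w) b' x y.
have R_equiv : RelationClasses.Equivalence R.
  split=> [z|z u [s bs szu]|z u t [s bs szu] [s' bs' sut]].
  - exists [::] => // b' _.
    have [+ _ _] := equiv_relP (eval_word (WJoin v w) b').
    exact.
  - exists s => // b' /szu.
    have [_ + _] := equiv_relP (eval_word (WJoin v w) b').
    exact.
  - exists (s ++ s'); first by rewrite /satisfies all_cat; apply/andP.
    move=> b'; rewrite /satisfies all_cat => /andP[/szu zu /sut ut].
    have [_ _ trans] := equiv_relP (eval_word (WJoin v w) b').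
    exact: trans zu ut.
move=> /(_ (MkEquiv R_equiv)); apply; apply/asboolP => z u /=.
  move=> /IHv[s bs sv]; exists s => // b' /sv.
  by have /asboolP := leUl (eval_word v b') (eval_word w b'); apply.
move=> /IHw[s bs sw]; exists s => // b' /sw.
by have /asboolP := leUr (eval_word w b') (eval_word v b'); apply.
Qed.

Lemma finite_tests_card_le : infinite_set [set: Omega] ->
  [set: J] #<= [set: Omega] ->
  [set: seq (J * (Omega * Omega))] #<= [set: Omega].
Proof.
move=> Oinf JO; apply: card_le_trans (infinite_seq_card_le Oinf).
have [f finj] := infinite_pairing Oinf.
have [k _ kinj] := card_le_fun (infinite_setN0 Oinf) JO.
pose code (t : J * (Omega * Omega)) := f (k t.1) (f t.2.1 t.2.2).
apply: (@inj_card_leP _ _ _ _ (map code)) => // s t _ _; apply: inj_map.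
move=> [j [x y]] [j' [x' y']] /finj[/kinj + /finj[/= -> ->]].
by rewrite !inE => /(_ I I) /= ->.
Qed.

End BasicOpenSets.

(** * Lower solution sets and chains over an embedded lattice *)

Section Embedding.
Variables (d : Order.disp_t) (A : latticeType d) (Omega J : Type).
Variables (f : A -> Equiv Omega) (fP : lattice_embedding f).

Fixpoint map_word (v : lattice_word A J) : lattice_word (Equiv Omega) J :=
  match v with
  | WVar j => WVar _ j
  | WConst c => WConst _ (f c)
  | WMeet v w => WMeet (map_word v) (map_word w)
  | WJoin v w => WJoin (map_word v) (map_word w)
  end.

Lemma eval_map_word v (a : J -> A) :
  eval_word (map_word v) (f \o a) = f (eval_word v a).
Proof.
have [_ fI fU] := fP.
by elim: v => //= v -> w ->; rewrite ?fI ?fU.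
Qed.

Lemma lattice_embedding_le x y : (f x <= f y)%O = (x <= y)%O.
Proof.
have [finj fI _] := fP.
by rewrite !leEmeet -fI (inj_eq finj).
Qed.

(** The point [a] violates some defining inequality v <= c, so a pair [(x, y)] lies in the image of
    v(a) but not in that of c. A finite test forcing [(x, y)] into the image of v(b) makes every [b]
    that passes it violate the same inequality. *)
Lemma lower_solution_open (X : set (J -> A)) a :
  lower_solution_sets X -> ~ X a ->
  exists2 s, satisfies (f \o a) s & forall b, X b -> ~~ satisfies (f \o b) s.
Proof.
move=> [F Fprin ->] /existsNP[S /not_implyP[FS nSa]].
have [v [c Sdef]] := Fprin _ FS.
have : ~ (forall x y, f (eval_word v a) x y -> f c x y).
  move=> vc; apply: nSa; rewrite Sdef /principal_solution_set /=.
  by rewrite -lattice_embedding_le; apply/asboolP.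
move=> /existsNP[x /existsNP[y /not_implyP[+ ncxy]]].
rewrite -eval_map_word => vaxy.
have [s as_ sv] := eval_word_open vaxy; exists s => // b Xb.
apply/negP => /sv; rewrite eval_map_word => vxy; apply: ncxy.
have : S b by exact: Xb.
rewrite Sdef /principal_solution_set /= -lattice_embedding_le.
by move/asboolP; apply.
Qed.

Lemma chain_jumps_card_le (C : set (L_le_const A J)) :
  chain C -> jumps C #<= [set: seq (J * (Omega * Omega))].
Proof.
move=> Cchain.
have val_le (X Y : L_le_const A J) : (X <= Y)%O <-> val X `<=` val Y.
  exact: iff_sym (rwP (subsetPset (val X) (val Y))).
(* [phi] assigns to each jump a test passed by some point of the upper set and by none of the lower;
   off the jumps it is arbitrary. *)
have [phi phiP] : {phi : _ & forall p, jumps C p ->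
    (exists2 a, val p.2 a & satisfies (f \o a) (phi p)) /\
    (forall b, val p.1 b -> ~~ satisfies (f \o b) (phi p))}.
  apply: (@choice _ _ (fun p s => jumps C p ->
    (exists2 a, val p.2 a & satisfies (f \o a) s) /\
    (forall b, val p.1 b -> ~~ satisfies (f \o b) s))) => p.
  have [[_ _ p12 _]|nj] := pselect (jumps C p); last by exists [::].
  have /existsNP[a /not_implyP[p2a np1a]] : ~ (val p.2 `<=` val p.1).
    by move=> /val_le; rewrite (lt_geF p12).
  have [s as_ sp] := lower_solution_open (set_mem (valP p.1)) np1a.
  by exists s => _; split=> //; exists a.
(* If [p.1 < q.1], the jump forces [p.2 <= q.1], so the point of [p.2] passing the common test would
   lie in [q.1], where no point passes it. *)
have jump_le p q : jumps C p -> jumps C q -> phi p = phi q -> ~ (p.1 < q.1)%O.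
  move=> jp jq pq lt_pq.
  have [[_ Cp2 _ np] [Cq1 _ _ _]] := (jp, jq).
  have [[[a p2a as_] _] [_ nq1]] := (phiP _ jp, phiP _ jq).
  have le21 : (p.2 <= q.1)%O.
    have [//|q1p2] := Cchain _ _ Cp2 Cq1.
    have [->//|ne] := eqVneq p.2 q.1.
    by case: np; exists q.1; split=> //; rewrite lt_neqAle eq_sym ne.
  by have /val_le/(_ a p2a)/nq1 := le21; rewrite -pq as_.
apply: (@inj_card_leP _ _ _ _ phi) => // p q /set_mem jp /set_mem jq pq.
have [[Cp1 Cp2 p12 np] [Cq1 Cq2 q12 nq]] := (jp, jq).
have eq1 : p.1 = q.1.
  have [npq nqp] := (jump_le _ _ jp jq pq, jump_le _ _ jq jp (esym pq)).
  have [le|le] := Cchain _ _ Cp1 Cq1; have := le; rewrite le_eqVlt.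
    by case/predU1P.
  by case/predU1P.
(* With equal lower ends, the smaller of two distinct upper ends would lie strictly inside the other
   jump. *)
have eq2 : p.2 = q.2.
  have [le|le] := Cchain _ _ Cp2 Cq2; have := le; rewrite le_eqVlt;
    move=> /predU1P[//|lt].
    by case: nq; exists p.2; rewrite -eq1.
  by case: np; exists q.2; rewrite eq1.
by rewrite [p]surjective_pairing [q]surjective_pairing eq1 eq2.
Qed.

End Embedding.

Theorem theorem6p4 (Omega J : Type)
    (infOmega : infinite_set [set: Omega])
    (leJOmega : [set: J] #<= [set: Omega]) :
  (~ exists C : set (L_le_const (Equiv Omega) J),
       chain C /\ card_lt [set: Omega] (jumps C))
  /\
  (forall (d : Order.disp_t) (A : latticeType d),
     (exists f : A -> Equiv Omega, lattice_embedding f) ->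
     ~ exists C : set (L_le_const A J),
         chain C /\ card_lt [set: Omega] (jumps C)).
Proof.
have main d (A : latticeType d) (f : A -> Equiv Omega) : lattice_embedding f ->
    ~ exists C : set (L_le_const A J),
        chain C /\ card_lt [set: Omega] (jumps C).
  move=> fP [C [Cchain [_]]]; apply.
  apply: card_le_trans (chain_jumps_card_le fP Cchain) _.
  exact: finite_tests_card_le.
split=> [|d A [f fP]]; last exact: main fP.
(* The lattice [Equiv Omega] itself is covered by its identity embedding. *)
by apply: (main _ _ id); split.
Qed.
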